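(* Let $(\mathfrak g,[\cdot,\cdot],\blacktriangleright_1)$ and $(\mathfrak g,[\cdot,\cdot],\blacktriangleright_2)$ be two post-Lie algebras (over the same Lie algebra). Assume that for all $x,y,z\in\mathfrak g$, $$x\blacktriangleright_1(y\blacktriangleright_2 z)-(x\blacktriangleright_1 y)\blacktriangleright_2 z=y\blacktriangleright_2(x\blacktriangleright_1 z)-(y\blacktriangleright_2 x)\blacktriangleright_1 z .$$ Then $(\mathfrak g,[\cdot,\cdot],\blacktriangleright_3)$ is a post-Lie algebra, with $$x\blacktriangleright_3 y:=x\blacktriangleright_1 y+x\blacktriangleright_2 y .$$
   Context: The base field $\mathbb K$ has characteristic zero. A post-Lie algebra $(\mathfrak g,[\cdot,\cdot],\blacktriangleright)$ is a Lie algebra $(\mathfrak g,[\cdot,\cdot])$ with a bilinear product $\blacktriangleright$ such that for all $x,y,z\in\mathfrak g$: $z\blacktriangleright[x,y]=[z\blacktriangleright x,y]+[x,z\blacktriangleright y]$ and $[x,y]\blacktriangleright z=\mathrm a_\blacktriangleright(x,y,z)-\mathrm a_\blacktriangleright(y,x,z)$, where $\mathrm a_\blacktriangleright(x,y,z)=x\blacktriangleright(y\blacktriangleright z)-(x\blacktriangleright y)\blacktriangleright z$. *)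

(* Defs.v *)
From mathcomp Require Import all_boot all_algebra.

Set Implicit Arguments.
Unset Strict Implicit.
Unset Printing Implicit Defensive.

Import GRing.Theory.
Local Open Scope ring_scope.

Record is_lie_algebra (K : fieldType) (g : lmodType K) (br : g -> g -> g) :
    Prop := IsLieAlgebra {
  lie_bilinear : bilinear_for *:%R *:%R br;
  lie_alternating : forall x, br x x = 0;
  lie_jacobi : forall x y z,
    br x (br y z) + br y (br z x) + br z (br x y) = 0
}.

Definition associator (V : zmodType) (m : V -> V -> V) (x y z : V) : V :=
  m x (m y z) - m (m x y) z.

Record is_post_lie_algebra (K : fieldType) (g : lmodType K)
    (br tr : g -> g -> g) : Prop := IsPostLieAlgebra {
  post_lie_is_lie : is_lie_algebra br;
  post_lie_bilinear : bilinear_for *:%R *:%R tr;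
  post_lie_derivation : forall x y z,
    tr z (br x y) = br (tr z x) y + br x (tr z y);
  post_lie_associator : forall x y z,
    tr (br x y) z = associator tr x y z - associator tr y x z
}.

(* Main.v *)
Require Import Defs.
From mathcomp Require Import all_boot all_algebra.

Set Implicit Arguments.
Unset Strict Implicit.
Unset Printing Implicit Defensive.

Import GRing.Theory.
Local Open Scope ring_scope.

(** Bilinearity and the derivation rule are linear in the product, so they pass
    to the sum at once.  The associator is quadratic: that of the sum is the sum
    of the two associators plus the cross terms [mixed_associator tr1 tr2] and
    [mixed_associator tr2 tr1] ([associator_add]).  The compatibility hypothesis
    says that exchanging [x] and [y] swaps these two cross terms, so that their
    sum is symmetric in [x] and [y] and cancels in the antisymmetrized
    associator.  What remains is the sum of the two given post-Lie
    identities. *)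

(** The polarization of the associator: [mixed_associator m m] is
    [associator m]. *)
Definition mixed_associator (V : zmodType) (m n : V -> V -> V) (x y z : V) : V :=
  m x (n y z) - n (m x y) z.

Lemma bilinear_for_addl (K : fieldType) (g : lmodType K) (m : g -> g -> g)
    (bil_m : bilinear_for *:%R *:%R m) x y z :
  m (x + y) z = m x z + m y z.
Proof. by have := bil_m.1 z 1 x y; rewrite /= !scale1r. Qed.

Lemma bilinear_for_addr (K : fieldType) (g : lmodType K) (m : g -> g -> g)
    (bil_m : bilinear_for *:%R *:%R m) x y z :
  m x (y + z) = m x y + m x z.
Proof. by have := bil_m.2 x 1 y z; rewrite /= !scale1r. Qed.

Lemma bilinear_for_add (K : fieldType) (g : lmodType K) (m n : g -> g -> g) :
    bilinear_for *:%R *:%R m -> bilinear_for *:%R *:%R n ->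
  bilinear_for *:%R *:%R (fun x y => m x y + n x y).
Proof.
move=> [m_l m_r] [n_l n_r]; split=> u a x y /=.
- by have /= -> := m_l u a x y; have /= -> := n_l u a x y;
    rewrite scalerDr addrACA.
- by have /= -> := m_r u a x y; have /= -> := n_r u a x y;
    rewrite scalerDr addrACA.
Qed.

Lemma associator_add (K : fieldType) (g : lmodType K) (m n : g -> g -> g)
    (bil_m : bilinear_for *:%R *:%R m) (bil_n : bilinear_for *:%R *:%R n)
    x y z :
  associator (fun u v => m u v + n u v) x y z =
    associator m x y z + associator n x y z
    + (mixed_associator m n x y z + mixed_associator n m x y z).
Proof.
rewrite /associator /mixed_associator.
rewrite !(bilinear_for_addr bil_m, bilinear_for_addr bil_n).
rewrite !(bilinear_for_addl bil_m, bilinear_for_addl bil_n).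
(* For [p], [q] in [{m, n}], the term [p x (q y z)] is paired with
   [- q (p x y) z], its rebracketing in infix notation. *)
by rewrite !opprD
  [LHS](AC ((2*2)*(2*2)) ((1*5)*(4*8)*((2*7)*(3*6)))).
Qed.

Theorem proposition4p15 (K : fieldType) (charK0 : [pchar K] =i pred0)
  (g : lmodType K) (br tr1 tr2 : g -> g -> g)
  (post_lie1 : is_post_lie_algebra br tr1)
  (post_lie2 : is_post_lie_algebra br tr2)
  (compat : forall x y z : g,
     tr1 x (tr2 y z) - tr2 (tr1 x y) z = tr2 y (tr1 x z) - tr1 (tr2 y x) z) :
  is_post_lie_algebra br (fun x y : g => tr1 x y + tr2 x y).
Proof.
case: post_lie1 => lie_br bil1 der1 ass1.
case: post_lie2 => _ bil2 der2 ass2.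
have bil_br := lie_bilinear lie_br.
split=> //; first exact: bilinear_for_add.
- move=> x y z; rewrite der1 der2 addrACA.
  by rewrite (bilinear_for_addl bil_br) (bilinear_for_addr bil_br).
- move=> x y z; rewrite ass1 ass2 !associator_add //.
  have swap u v :
    mixed_associator tr1 tr2 u v z = mixed_associator tr2 tr1 v u z.
    exact: compat.
  (* The two sums of cross terms become equal and cancel. *)
  rewrite !swap [mixed_associator tr2 tr1 x y z + _]addrC.
  rewrite [X in _ = _ + X]opprD [RHS]addrACA subrr addr0.
  by rewrite [X in _ = _ + X]opprD [RHS]addrACA.
Qed.
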